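(* Let $x,y\ge 0$, $a,b>0$, $\mu,\nu>0$ be real numbers. (1) If $p\ge 2$ and $\frac1p+\frac1q=1$, then $$\frac{x^p}{\mu}+\frac{y^p}{\nu}\ \ge\ \frac{(ax+by)^p}{\left(\mu^{\frac1{p-1}}a^q+\nu^{\frac1{p-1}}b^q\right)^{p-1}}+\mu^{\frac1{p-1}}a^q\left|\left(\frac1{a\mu}\right)^{\frac1{p-1}}x-\frac{ax+by}{\mu^{\frac1{p-1}}a^q+\nu^{\frac1{p-1}}b^q}\right|^p+\nu^{\frac1{p-1}}b^q\left|\left(\frac1{\nu b}\right)^{\frac1{p-1}}y-\frac{ax+by}{\mu^{\frac1{p-1}}a^q+\nu^{\frac1{p-1}}b^q}\right|^p .$$ (2) In particular, for $p=2$ equality holds, which gives $$\frac{x^2}{\mu}+\frac{y^2}{\nu}=\frac{(ax+by)^2}{\mu a^2+\nu b^2}+\frac{(\nu bx-a\mu y)^2}{\mu\nu(\mu a^2+\nu b^2)} .$$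
   Context: All powers are real powers of nonnegative real numbers (squares may be of arbitrary reals). *)

(* Defs.v *)
From mathcomp Require Import all_boot all_order all_algebra.
From mathcomp Require Import all_classical all_reals all_analysis.
Set Implicit Arguments.
Unset Strict Implicit.
Unset Printing Implicit Defensive.
Import Order.TTheory GRing.Theory Num.Theory.
Local Open Scope ring_scope.

(* [powR] is the usual real power on nonnegative bases (0 `^ r = 0 for r > 0);
   on negative bases its value is junk, but every base below is nonnegative
   whenever x, y >= 0 and a, b, mu, nu > 0. *)
Section RefinedSum.
Variables (R : realType) (p q : R) (x y a b mu nu : R).

Definition power_sum : R := x `^ p / mu + y `^ p / nu.

Definition weight (c m : R) : R := m `^ (1 / (p - 1)) * c `^ q.

Definition weight_sum : R := weight a mu + weight b nu.

Definition refined_bound : R :=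
  (a * x + b * y) `^ p / weight_sum `^ (p - 1)
  + weight a mu
    * `| (1 / (a * mu)) `^ (1 / (p - 1)) * x
         - (a * x + b * y) / weight_sum | `^ p
  + weight b nu
    * `| (1 / (nu * b)) `^ (1 / (p - 1)) * y
         - (a * x + b * y) / weight_sum | `^ p.

End RefinedSum.

(* Main.v *)
Require Import Defs.
From mathcomp Require Import all_boot all_order all_algebra.
From mathcomp Require Import all_classical all_reals all_analysis.
From mathcomp Require Import ring lra.
Import Order.TTheory GRing.Theory Num.Theory.
Local Open Scope ring_scope.

(** For [p >= 2] the function [t |-> t `^ p] is superquadratic: on [t, s >= 0]
    it exceeds its tangent line at [s] not merely by something nonnegative, but
    by at least [`|t - s| `^ p] ([powR_superquadratic]).  Averaging this bound
    over two points [u], [v] with weights [al], [be], at their barycentre [s],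
    makes the linear terms cancel and gives a Jensen inequality with remainder
    ([powR_refined_jensen]).

    The theorem is this inequality in other coordinates.  Take for [al] and
    [be] the two weights of the statement, and for [u] and [v] the rescaled
    variables inside the absolute values.  Then [al * u = a * x], so that the
    barycentre is [(a * x + b * y) / (al + be)] ([weight_scaled]), while
    [al * u `^ p = x `^ p / mu] ([weight_scaled_powR]).

    Superquadraticity itself needs no derivative.  Writing
    [t `^ p = s * t `^ (p - 1) + (t - s) * t `^ (p - 1)], the first summand is
    bounded below by the tangent line of the convex power [p - 1 >= 1], which
    is a form of Young's inequality, and the second by superadditivity of that
    same power.

    For [p = 2] the remainder in the tangent line bound is exactly
    [(t - s) ^+ 2], and the inequality becomes the parallel axis identity for
    the second moment about the barycentre. *)

(** Young's inequality for [t] and [s `^ (r - 1)] with exponents [r] and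
    [r / (r - 1)]; these are conjugate only when [r != 1]. *)
Lemma powR_tangent (R : realType) (r t s : R) :
  1 <= r -> 0 <= t -> 0 <= s ->
  r * (t * s `^ (r - 1)) <= t `^ r + (r - 1) * s `^ r.
Proof.
rewrite le_eqVlt => /predU1P[<-|r1] t0 s0.
  by rewrite subrr powRr0 powRr1// mul0r addr0 mulr1 mul1r.
have r0 : 0 < r by lra.
have r10 : 0 < r - 1 by lra.
have conj : r^-1 + (r / (r - 1))^-1 = 1.
  by field; rewrite !gt_eqF.
have := conjugate_powR t0 (powR_ge0 s (r - 1)) r0 (divr_gt0 r0 r10) conj.
rewrite -powRrM mulrCA divff ?gt_eqF// mulr1 -(ler_pM2l r0) => /le_trans; apply.
rewrite le_eqVlt; apply/orP; left; apply/eqP; field.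
by rewrite !gt_eqF.
Qed.

(** Split [(u + v) `^ r] as [u * (u + v) `^ (r - 1) + v * (u + v) `^ (r - 1)]:
    the power [r - 1 >= 0] is monotone. *)
Lemma powR_superadditive (R : realType) (r u v : R) :
  1 <= r -> 0 <= u -> 0 <= v -> u `^ r + v `^ r <= (u + v) `^ r.
Proof.
move=> r1 u0 v0.
have r0 : 0 < r by lra.
have uv0 : 0 <= u + v by rewrite addr_ge0.
have mono w : 0 <= w -> w <= u + v -> w `^ (r - 1) <= (u + v) `^ (r - 1).
  by move=> w0 wuv; apply: ge0_ler_powR; rewrite ?nnegrE// subr_ge0.
rewrite -!(mulr_powRB1 _ r0)// mulrDl.
by apply: lerD; apply: ler_wpM2l => //; apply: mono => //; lra.
Qed.

(** The expansion [t = s + (t - s)] of one factor of [t `^ p] produces the slope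
    [p] as [(p - 1) + 1]: convexity of the power [p - 1] gives the first part,
    and the other is left over after superadditivity has extracted the
    remainder. *)
Lemma powR_superquadratic (R : realType) (p t s : R) :
  2 <= p -> 0 <= t -> 0 <= s ->
  s `^ p + p * s `^ (p - 1) * (t - s) + `|t - s| `^ p <= t `^ p.
Proof.
move=> p2 t0 s0.
have p0 : 0 < p by lra.
have p1 : 1 <= p - 1 by lra.
have p10 : 0 < p - 1 by lra.
have tangent : s * (p - 1) * t * s `^ (p - 1 - 1)
    <= s * (t `^ (p - 1) + (p - 1 - 1) * s `^ (p - 1)).
  by rewrite -!mulrA; apply: ler_wpM2l => //; exact: powR_tangent.
have superadd : `|t - s| * `|t - s| `^ (p - 1)
    <= (t - s) * (t `^ (p - 1) - s `^ (p - 1)).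
  case: (leP s t) => ts.
    rewrite ger0_norm ?subr_ge0//; apply: ler_wpM2l; first by rewrite subr_ge0.
    have ts0 : 0 <= t - s by lra.
    by have := powR_superadditive _ _ _ _ p1 ts0 s0; rewrite subrK; lra.
  (* Here [s = t + (s - t)], and both factors on the right are nonpositive. *)
  rewrite ltr0_norm ?subr_lt0// -[leRHS]mulrNN opprB; apply: ler_wpM2l; first by lra.
  have ts0 : 0 <= s - t by lra.
  by have := powR_superadditive _ _ _ _ p1 ts0 t0; rewrite subrK; lra.
have sE := mulr_powRB1 s0 p10.
rewrite -(mulr_powRB1 t0 p0) -(mulr_powRB1 s0 p0).
rewrite -(mulr_powRB1 (normr_ge0 (t - s)) p0).
have tE : s * (p - 1) * t * s `^ (p - 1 - 1) = (p - 1) * t * s `^ (p - 1).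
  by rewrite -sE; ring.
rewrite tE in tangent.
by lra.
Qed.

(** The value of the power at the barycentre is written in the homogeneous form
    [W * (S / W) `^ p = S `^ p / W `^ (p - 1)]. *)
Lemma powR_refined_jensen (R : realType) (p al be u v : R) :
  2 <= p -> 0 < al -> 0 < be -> 0 <= u -> 0 <= v ->
  (al * u + be * v) `^ p / (al + be) `^ (p - 1)
    + al * `|u - (al * u + be * v) / (al + be)| `^ p
    + be * `|v - (al * u + be * v) / (al + be)| `^ p
  <= al * u `^ p + be * v `^ p.
Proof.
move=> p2 al0 be0 u0 v0.
have p0 : 0 < p by lra.
have W0 : 0 < al + be by rewrite addr_gt0.
have S0 : 0 <= al * u + be * v by rewrite addr_ge0// mulr_ge0// ltW.
set s := (al * u + be * v) / (al + be).
have s0 : 0 <= s by rewrite divr_ge0// ltW.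
have SE : al * u + be * v = (al + be) * s.
  by rewrite /s mulrCA divff ?mulr1// gt_eqF.
have -> : (al * u + be * v) `^ p / (al + be) `^ (p - 1) = (al + be) * s `^ p.
  rewrite SE powRM// ?(ltW W0)// -(mulr_powRB1 (ltW W0) p0).
  by field; rewrite gt_eqF// powR_gt0.
have Hu := ler_wpM2l (ltW al0) (powR_superquadratic _ _ _ _ p2 u0 s0).
have Hv := ler_wpM2l (ltW be0) (powR_superquadratic _ _ _ _ p2 v0 s0).
have cancel : al * (p * s `^ (p - 1) * (u - s))
              + be * (p * s `^ (p - 1) * (v - s)) = 0.
  have -> : al * (p * s `^ (p - 1) * (u - s))
      + be * (p * s `^ (p - 1) * (v - s))
    = p * s `^ (p - 1) * (al * u + be * v - (al + be) * s) by ring.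
  by rewrite SE subrr mulr0.
by lra.
Qed.

Lemma sqr_jensen_identity (R : realType) (al be u v : R) :
  0 < al -> 0 < be -> 0 <= u -> 0 <= v ->
  (al * u + be * v) `^ 2 / (al + be) `^ (2 - 1)
    + al * `|u - (al * u + be * v) / (al + be)| `^ 2
    + be * `|v - (al * u + be * v) / (al + be)| `^ 2
  = al * u `^ 2 + be * v `^ 2.
Proof.
move=> al0 be0 u0 v0.
have W0 : 0 < al + be by rewrite addr_gt0.
have S0 : 0 <= al * u + be * v by rewrite addr_ge0// mulr_ge0// ltW.
have -> : 2 - 1 = 1 :> R by ring.
rewrite powRr1 ?(ltW W0)// !powR_mulrn// !real_normK ?num_real//.
by field; rewrite gt_eqF.
Qed.

Lemma conjugate_exponent (R : realType) (p q : R) :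
  1 < p -> 1 / p + 1 / q = 1 -> q = 1 + 1 / (p - 1).
Proof.
move=> p1; rewrite !div1r => pq.
have p0 : p != 0 by rewrite gt_eqF//; lra.
have p10 : p - 1 != 0 by rewrite gt_eqF//; lra.
have -> : q = (1 - p^-1)^-1 by rewrite -pq addrC addKr invrK.
by field; rewrite p0 p10.
Qed.

Section Weights.
Variables (R : realType) (p q c m x : R).
Hypotheses (p1 : 1 < p) (pq : 1 / p + 1 / q = 1).
Hypotheses (c0 : 0 < c) (m0 : 0 < m) (x0 : 0 <= x).

Lemma weight_gt0 : 0 < weight p q c m.
Proof. by rewrite mulr_gt0 ?powR_gt0. Qed.

(** With [e = 1 / (p - 1)] the weight is [m `^ e * c `^ (1 + e)], and the
    scaling factor is the inverse of [m `^ e * c `^ e]. *)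
Lemma weight_scaled :
  weight p q c m * ((1 / (c * m)) `^ (1 / (p - 1)) * x) = c * x.
Proof.
rewrite /weight (conjugate_exponent _ _ _ p1 pq).
set e := 1 / (p - 1).
rewrite powRD ?(gt_eqF c0) ?implybT// powRr1 ?(ltW c0)//.
rewrite div1r -powR_inv1 ?mulr_ge0 ?ltW// powRAC powR_inv1 ?powR_ge0//.
rewrite powRM ?ltW//.
by field; rewrite !gt_eqF// powR_gt0.
Qed.

(** One factor of the power is absorbed by the weight, and the remaining
    exponent [p - 1] undoes the root in the scaling factor. *)
Lemma weight_scaled_powR :
  weight p q c m * ((1 / (c * m)) `^ (1 / (p - 1)) * x) `^ p = x `^ p / m.
Proof.
have p0 : 0 < p := lt_trans ltr01 p1.
have cm0 : 0 <= 1 / (c * m) by rewrite divr_ge0// mulr_ge0// ltW.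
have u0 : 0 <= (1 / (c * m)) `^ (1 / (p - 1)) * x.
  by rewrite mulr_ge0// powR_ge0.
rewrite -(mulr_powRB1 u0 p0) mulrA weight_scaled powRM ?powR_ge0// -powRrM.
rewrite divfK; last by rewrite gt_eqF// subr_gt0.
rewrite powRr1// -(mulr_powRB1 x0 p0).
by field; rewrite !gt_eqF.
Qed.

End Weights.

Theorem corollary2 (R : realType) (x y a b mu nu : R)
    (hx : 0 <= x) (hy : 0 <= y) (ha : 0 < a) (hb : 0 < b)
    (hmu : 0 < mu) (hnu : 0 < nu) :
  (forall p q : R, 2 <= p -> 1 / p + 1 / q = 1 ->
     power_sum p x y mu nu >= refined_bound p q x y a b mu nu)
  /\ (forall q : R, 1 / 2 + 1 / q = 1 ->
     power_sum 2 x y mu nu = refined_bound 2 q x y a b mu nu)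
  /\ x ^+ 2 / mu + y ^+ 2 / nu
     = (a * x + b * y) ^+ 2 / (mu * a ^+ 2 + nu * b ^+ 2)
       + (nu * b * x - a * mu * y) ^+ 2
         / (mu * nu * (mu * a ^+ 2 + nu * b ^+ 2)).
Proof.
split; [|split].
- move=> p q p2 pq; have p1 : 1 < p by lra.
  rewrite /power_sum /refined_bound /weight_sum (mulrC nu b).
  rewrite -(weight_scaled_powR _ _ _ _ _ _ p1 pq ha hmu hx).
  rewrite -(weight_scaled_powR _ _ _ _ _ _ p1 pq hb hnu hy).
  rewrite -(weight_scaled _ _ _ _ _ x p1 pq ha hmu).
  rewrite -(weight_scaled _ _ _ _ _ y p1 pq hb hnu).
  by apply: powR_refined_jensen; rewrite ?weight_gt0// mulr_ge0// powR_ge0.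
- move=> q pq; have p1 : 1 < 2 :> R by lra.
  rewrite /power_sum /refined_bound /weight_sum (mulrC nu b).
  rewrite -(weight_scaled_powR _ _ _ _ _ _ p1 pq ha hmu hx).
  rewrite -(weight_scaled_powR _ _ _ _ _ _ p1 pq hb hnu hy).
  rewrite -(weight_scaled _ _ _ _ _ x p1 pq ha hmu).
  rewrite -(weight_scaled _ _ _ _ _ y p1 pq hb hnu).
  by rewrite sqr_jensen_identity ?weight_gt0// mulr_ge0// powR_ge0.
- have W0 : 0 < mu * a ^+ 2 + nu * b ^+ 2.
    by rewrite addr_gt0// mulr_gt0// exprn_gt0.
  by field; rewrite !gt_eqF.
Qed.
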